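(* Let $Q$ be a commutative quandle of order $\geq 2$. Then there exists no commutative biquandle $X$ whose associated quandle $\mathcal{Q}(X)$ is $Q$.
   Context: A quandle is a set $Q$ with an operation $*$ such that $x*x=x$; each map $x\mapsto x*y$ is a bijection; and $(x*y)*z=(x*z)*(y*z)$. It is commutative if $x*y=y*x$ for all $x,y$. A biquandle is a set $X$ with two binary operations $\underline{\ast},\overline{\ast}$ such that: (i) $x\,\underline{\ast}\,x=x\,\overline{\ast}\,x$ for all $x$; (ii) for every $y$ the maps $x\mapsto x\,\underline{\ast}\,y$ and $x\mapsto x\,\overline{\ast}\,y$ are bijections of $X$, and $S(x,y)=(y\,\overline{\ast}\,x,\;x\,\underline{\ast}\,y)$ is a bijection of $X\times X$; (iii) for all $x,y,z$: $(x\underline{\ast}y)\underline{\ast}(z\underline{\ast}y)=(x\underline{\ast}z)\underline{\ast}(y\overline{\ast}z)$, $(x\underline{\ast}y)\overline{\ast}(z\underline{\ast}y)=(x\overline{\ast}z)\underline{\ast}(y\overline{\ast}z)$, $(x\overline{\ast}y)\overline{\ast}(z\overline{\ast}y)=(x\overline{\ast}z)\overline{\ast}(y\underline{\ast}z)$. A biquandle is commutative if $x\,\underline{\ast}\,y=y\,\underline{\ast}\,x$ and $x\,\overline{\ast}\,y=y\,\overline{\ast}\,x$ for all $x,y$. The associated quandle $\mathcal{Q}(X)$ of a biquandle $X$ is the set $X$ with operation $x*y=\beta_y^{-1}(x\,\underline{\ast}\,y)$, where $\beta_y(x)=x\,\overline{\ast}\,y$ (this is a quandle, a known fact). *)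

(* Defs.v *)
From mathcomp Require Import all_boot boolp.

Set Implicit Arguments.
Unset Strict Implicit.
Unset Printing Implicit Defensive.

Section Inverse.
Variables (A B : Type) (f : A -> B) (bij_f : bijective f).

Lemma bij_inv_subproof : exists g : B -> A, cancel f g /\ cancel g f.
Proof. by case: bij_f => g fK gK; exists g. Qed.

(* [bijective] lives in Prop, so the two-sided inverse has to be chosen. *)
Definition bij_inv : B -> A := sval (cid bij_inv_subproof).

Lemma bij_invK : cancel f bij_inv.
Proof. by rewrite /bij_inv; case: (cid _) => g []. Qed.

Lemma bij_invKV : cancel bij_inv f.
Proof. by rewrite /bij_inv; case: (cid _) => g []. Qed.

End Inverse.

(* Carriers are arbitrary types: neither structure is assumed finite. *)
Record quandle : Type := Quandle {
  quandle_carrier :> Type;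
  qop : quandle_carrier -> quandle_carrier -> quandle_carrier;
  qop_idem : forall x, qop x x = x;
  qop_bij : forall y, bijective (fun x => qop x y);
  qop_dist : forall x y z, qop (qop x y) z = qop (qop x z) (qop y z)
}.

Definition commutative_quandle (Q : quandle) : Prop :=
  forall x y : Q, qop x y = qop y x.

(* "The associated quandle of X is Q" is read up to isomorphism; equality of
   quandles is the special case of the identity. *)
Definition quandle_iso (Q1 Q2 : quandle) : Prop :=
  exists f : Q1 -> Q2,
    bijective f /\ forall x y, f (qop x y) = qop (f x) (f y).

Reserved Notation "x \under y" (at level 40, left associativity).
Reserved Notation "x \over y" (at level 40, left associativity).

Record biquandle : Type := Biquandle {
  biquandle_carrier :> Type;
  under : biquandle_carrier -> biquandle_carrier -> biquandle_carrier
    where "x \under y" := (under x y);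
  over : biquandle_carrier -> biquandle_carrier -> biquandle_carrier
    where "x \over y" := (over x y);
  under_over_diag : forall x, x \under x = x \over x;
  under_bij : forall y, bijective (fun x => x \under y);
  over_bij : forall y, bijective (fun x => x \over y);
  switch_bij :
    bijective (fun p : biquandle_carrier * biquandle_carrier =>
                 (p.2 \over p.1, p.1 \under p.2));
  under_under : forall x y z,
    (x \under y) \under (z \under y) = (x \under z) \under (y \over z);
  under_over : forall x y z,
    (x \under y) \over (z \under y) = (x \over z) \under (y \over z);
  over_over : forall x y z,
    (x \over y) \over (z \over y) = (x \over z) \over (y \under z)
}.

Notation "x \under y" := (under x y).
Notation "x \over y" := (over x y).

Definition commutative_biquandle (X : biquandle) : Prop :=
  (forall x y : X, x \under y = y \under x) /\
  (forall x y : X, x \over y = y \over x).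

Section AssociatedQuandle.
Variable X : biquandle.
Implicit Types x y z : X.

Definition beta y : X -> X := fun x => x \over y.

Definition assoc_op x y : X :=
  bij_inv (over_bij y : bijective (beta y)) (x \under y).

Lemma assoc_opK x y : assoc_op x y \over y = x \under y.
Proof. exact: (bij_invKV (over_bij y : bijective (beta y))). Qed.

Lemma assoc_op_idem x : assoc_op x x = x.
Proof. by apply: (bij_inj (over_bij x)); rewrite assoc_opK under_over_diag. Qed.

Lemma assoc_op_bij y : bijective (fun x => assoc_op x y).
Proof.
exists (fun x => bij_inv (under_bij y) (x \over y)) => x.
  by rewrite assoc_opK (bij_invK (under_bij y)).
apply: (bij_inj (over_bij y)); rewrite assoc_opK.
exact: (bij_invKV (under_bij y)).
Qed.

Lemma assoc_op_dist x y z :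
  assoc_op (assoc_op x y) z = assoc_op (assoc_op x z) (assoc_op y z).
Proof.
apply: (bij_inj (over_bij z)); apply: (bij_inj (over_bij (y \under z))).
rewrite assoc_opK under_over assoc_opK -[in RHS](assoc_opK y z).
by rewrite over_over assoc_opK under_over !assoc_opK under_under.
Qed.

Definition associated_quandle : quandle :=
  Quandle assoc_op_idem assoc_op_bij assoc_op_dist.

End AssociatedQuandle.

(* Main.v *)
Require Import Defs.
From mathcomp Require Import all_boot.

(* Write [z] for [assoc_op x y = assoc_op y x]. Commutativity of [\under] gives
   [z \over y = x \under y = y \under x = z \over x], hence
   [y \over z = x \over z] by commutativity of [\over], and [x = y]. *)
Lemma commutative_assoc_op_eq (X : biquandle) (x y : X) :
  commutative_biquandle X -> assoc_op x y = assoc_op y x -> x = y.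
Proof.
move=> [underC overC] opC; apply: (bij_inj (over_bij (assoc_op x y))).
(* Only the left occurrence of [assoc_op x y] is flipped, so that each side has the form required by
   [assoc_opK]. *)
by rewrite /= overC [RHS]overC {1}opC !assoc_opK underC.
Qed.

Theorem lemma3p11 (Q : quandle) (Q_comm : commutative_quandle Q)
    (Q_order_ge2 : exists x y : Q, x <> y) :
  ~ exists X : biquandle,
      commutative_biquandle X /\ quandle_iso (associated_quandle X) Q.
Proof.
case: Q_order_ge2 => a [b neq_ab] [X [X_comm [f [[g fK gK] fM]]]].
(* Since [g] is injective, it suffices that [g a] and [g b] commute under [assoc_op]. *)
apply/neq_ab/(can_inj gK); apply: (commutative_assoc_op_eq _ _ _ X_comm).
(* Commutativity is pulled back from [Q] along the injective [f]; [assoc_op] is by conversion the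
   [qop] of [associated_quandle X], so [fM] applies. *)
apply: (can_inj fK); rewrite (fM (g a) (g b)) (fM (g b) (g a)).
exact: Q_comm.
Qed.
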